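(* The map $\iota:\mathcal{K}(D^2\times I)\to\mathcal{K}(\mathcal{A}\times I)$ induced by the inclusion of a thickened disc in the thickened annulus is an injection. Moreover, there is a surjection $\rho$ of the set $\mathcal{K}(\mathcal{A}\times I)$ onto the set $\mathcal{K}(D^2\times I)$, namely the map induced by the inclusion of the thickened annulus in a thickened disc.
   Context: $\mathcal{A}=S^1\times D^1$ is the annulus, $D^2$ a disc, $I=[0,1]$. For $\Sigma\in\{D^2,\mathcal{A}\}$, a multi-knotoid in $\Sigma\times I$ consists of two disjoint parallel segments $L$ and $H$ (rails), each of the form $\{\text{point}\}\times I$ with the point in the interior of $\Sigma$, together with an open embedded curve with its leg on $L$ and its head on $H$ and otherwise disjoint from the rails, and finitely many (possibly zero) disjoint embedded closed curves, disjoint from the rails and the open curve; all curves lie in the interior of $\Sigma\times I$, except that the endpoints may lie in the interiors of $\Sigma\times\{0\}$ and $\Sigma\times\{1\}$. Rail isotopy is generated by ambient isotopies of $\Sigma\times I$ taking place in its interior and in the complement of the rails, keeping the endpoints attached to their rails but allowing them to slide along them, and rail shifts, i.e. parallel shifts of the rails up to isotopy (a rail may not cross an arc of the curves). $\mathcal{K}(\Sigma\times I)$ is the set of rail isotopy classes. The thickened disc is included in $\mathcal{A}\times I$ as (embedded disc in the interior of $\mathcal{A}$)$\times I$, and $\mathcal{A}\times I$ is included in $D^2\times I$ by viewing $\mathcal{A}$ as a disc with a central hole; rails $\{\text{point}\}\times I$ are mapped to rails. *)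

(* Defs.v *)
From HB Require Import structures.
From Stdlib Require Import Relations.
From mathcomp Require Import all_boot all_order all_algebra generic_quotient.
From mathcomp Require Import all_classical all_reals all_analysis.

Set Implicit Arguments.
Unset Strict Implicit.
Unset Printing Implicit Defensive.

Import Order.TTheory GRing.Theory Num.Theory.
Import numFieldNormedType.Exports.

Local Open Scope classical_set_scope.
Local Open Scope ring_scope.

Notation plane R := (R * R)%type.
Notation space R := (R * R * R)%type.

Definition unit_interval (R : realType) : set R := `[0, 1]%classic.
Arguments unit_interval R : clear implicits.

Definition disc (R : realType) : set (plane R) :=
  [set z | z.1 ^+ 2 + z.2 ^+ 2 <= 1].
Arguments disc R : clear implicits.

(* S^1 x D^1, realized as the annulus 1/2 <= |z| <= 1. *)
Definition annulus (R : realType) : set (plane R) :=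
  [set z | 1 / 4 <= z.1 ^+ 2 + z.2 ^+ 2 <= 1].
Arguments annulus R : clear implicits.

Definition unit_circle (R : realType) : set (plane R) :=
  [set z | z.1 ^+ 2 + z.2 ^+ 2 = 1].
Arguments unit_circle R : clear implicits.

Definition thick (R : realType) (S : set (plane R)) : set (space R) :=
  S `*` unit_interval R.

Definition rail (R : realType) (p : plane R) : set (space R) :=
  thick [set p].

(* Used only for compact S and Hausdorff U, where a continuous injection is a
   homeomorphism onto its image. *)
Definition embedding (T U : topologicalType) (S : set T) (f : T -> U) : Prop :=
  {within S, continuous f} /\ set_inj S f.

Definition segment (R : realType) (a b : space R) : set (space R) :=
  [set x | exists2 t : R, unit_interval R t & x = (1 - t) *: a + t *: b].

(* Wild curves are excluded: some neighbourhood U of X embeds in 3-space as an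
   open set, respecting the slab of height [0, 1], so that X becomes a finite
   union of straight segments. By the theorems of Bing and Moise this amounts
   to tameness in the usual sense (equivalently, local tameness). *)
Definition tame (R : realType) (X : set (space R)) : Prop :=
  exists (U : set (space R)) (phi : space R -> space R)
         (s : seq (space R * space R)),
  [/\ open U /\ X `<=` U,
      (forall x, U x -> {for x, continuous phi}) /\ set_inj U phi,
      forall V : set (space R), open V -> V `<=` U -> open (phi @` V),
      forall x, U x -> (unit_interval R x.2 <-> unit_interval R (phi x).2) &
      phi @` X = \bigcup_(e in [set` s]) segment e.1 e.2].

(* A knotoid is an unparametrized subset of S x I; its open curve is directed
   by the labelling of the two rails, its closed curves are unoriented. *)
Record multi_knotoid (R : realType) (S : set (plane R)) := MultiKnotoid {
  leg_rail : plane R;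
  head_rail : plane R;
  open_curve : set (space R);
  closed_curves : set (set (space R));
  leg_rail_interior : S° leg_rail;
  head_rail_interior : S° head_rail;
  rails_disjoint : leg_rail <> head_rail;
  (* g 0 and g 1 may have height 0 or 1 *)
  open_curveP : exists g : R -> space R,
    [/\ embedding (unit_interval R) g,
        g @` unit_interval R = open_curve,
        rail leg_rail (g 0), rail head_rail (g 1) &
        g @` `]0, 1[%classic `<=`
          (thick S)° `\` (rail leg_rail `|` rail head_rail)];
  closed_curves_finite : finite_set closed_curves;
  closed_curvesP : forall C, closed_curves C ->
    [/\ exists2 g : plane R -> space R,
          embedding (unit_circle R) g & g @` unit_circle R = C,
        C `<=` (thick S)° `\` (rail leg_rail `|` rail head_rail) &
        C `&` open_curve = set0];
  closed_curves_disjoint : trivIset closed_curves id;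
  tame_diagram : tame (rail leg_rail `|` rail head_rail `|` open_curve `|`
                       \bigcup_(C in closed_curves) C) }.

(* As S is compact in all uses, each H t is a homeomorphism of S x I. *)
Definition ambient_isotopy (R : realType) (S : set (plane R))
    (H : R -> space R -> space R) : Prop :=
  [/\ {within unit_interval R `*` thick S,
        continuous (fun tx : R * space R => H tx.1 tx.2)},
      forall t, unit_interval R t -> set_bij (thick S) (thick S) (H t) &
      forall x, thick S x -> H 0 x = x].

Definition carries_curves (R : realType) (S : set (plane R))
    (f : space R -> space R) (k k' : multi_knotoid S) : Prop :=
  open_curve k' = f @` open_curve k /\
  closed_curves k' = [set f @` C | C in closed_curves k].

(* The rails are preserved as sets only, so that the endpoints can slide. *)
Definition rail_fixing_isotopic (R : realType) (S : set (plane R))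
    (k k' : multi_knotoid S) : Prop :=
  exists H : R -> space R -> space R,
  [/\ ambient_isotopy S H,
      forall t x, unit_interval R t -> (thick S `\` (thick S)°) x -> H t x = x,
      forall t, unit_interval R t ->
        H t @` rail (leg_rail k) = rail (leg_rail k) /\
        H t @` rail (head_rail k) = rail (head_rail k),
      leg_rail k' = leg_rail k /\ head_rail k' = head_rail k &
      carries_curves (H 1) k k'].

(* The rails move, staying parallel, along the paths p and q; the ambient
   isotopy drags the curves along, so that no rail crosses them. *)
Definition rail_shift (R : realType) (S : set (plane R))
    (k k' : multi_knotoid S) : Prop :=
  exists (H : R -> space R -> space R) (p q : R -> plane R),
  [/\ ambient_isotopy S H,
      forall t x, unit_interval R t -> thick (S `\` S°) x -> H t x = x,
      forall t, unit_interval R t ->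
        H t @` rail (leg_rail k) = rail (p t) /\
        H t @` rail (head_rail k) = rail (q t),
      leg_rail k' = p 1 /\ head_rail k' = q 1 &
      carries_curves (H 1) k k'].

Definition rail_isotopic (R : realType) (S : set (plane R)) :
    multi_knotoid S -> multi_knotoid S -> Prop :=
  clos_refl_sym_trans _
    (fun k k' => rail_fixing_isotopic k k' \/ rail_shift k k').

HB.instance Definition _ (R : realType) (S : set (plane R)) :=
  gen_eqMixin (multi_knotoid S).
HB.instance Definition _ (R : realType) (S : set (plane R)) :=
  gen_choiceMixin (multi_knotoid S).

Definition rail_isotopicb (R : realType) (S : set (plane R)) :
    rel (multi_knotoid S) := fun k k' => `[< rail_isotopic k k' >].

Lemma rail_isotopicb_equiv (R : realType) (S : set (plane R)) :
  equiv_class_of (@rail_isotopicb R S).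
Proof.
split=> [k|k k'|k2 k1 k3].
- by apply/asboolP; apply: rst_refl.
- by apply/asboolP/asboolP; apply: rst_sym.
- by move=> /asboolP h1 /asboolP h2; apply/asboolP; apply: rst_trans h1 h2.
Qed.

Canonical rail_isotopy_equiv (R : realType) (S : set (plane R)) :=
  EquivRelPack (@rail_isotopicb_equiv R S).

Definition knotoid_classes (R : realType) (S : set (plane R)) :=
  {eq_quot (@rail_isotopicb R S)}%qT.

Definition knotoid_class (R : realType) (S : set (plane R))
    (k : multi_knotoid S) : knotoid_classes S :=
  (\pi_({eq_quot (@rail_isotopicb R S)}) k)%qT.

(* For compact S, emb_open is automatic, by invariance of domain. *)
Record surface_embedding (R : realType) (S S' : set (plane R)) :=
  SurfaceEmbedding {
  emb_map :> plane R -> plane R;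
  emb_embedding : embedding S emb_map;
  emb_sub : emb_map @` S `<=` S';
  emb_open : forall V : set (plane R),
    open V -> V `<=` S° -> open (emb_map @` V) }.

Definition thick_map (R : realType) (j : plane R -> plane R)
    (x : space R) : space R := (j x.1, x.2).

Lemma thick_map_inj (R : realType) (S S' : set (plane R))
    (j : surface_embedding S S') : set_inj (S `*` setT) (thick_map j).
Proof.
move=> [a s] [b t] /set_mem[/= Sa _] /set_mem[/= Sb _] [jab st].
by rewrite st ((emb_embedding j).2 a b (mem_set Sa) (mem_set Sb) jab).
Qed.

Lemma thick_map_thick (R : realType) (S S' : set (plane R))
    (j : surface_embedding S S') x : thick S x -> thick S' (thick_map j x).
Proof. by move=> [Sx Ix]; split=> //; apply: (@emb_sub _ _ _ j); exists x.1. Qed.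

Lemma within_comp (T U V : topologicalType) (A : set T) (B : set U)
    (g : T -> U) (f : U -> V) :
  g @` A `<=` B -> {within A, continuous g} -> {within B, continuous f} ->
  {within A, continuous (f \o g)}.
Proof.
move=> gAB /subspace_continuousP cg /subspace_continuousP cf.
apply/subspace_continuousP => x Ax.
have Bgx : B (g x) by apply: gAB; exists x.
apply: (@cvg_comp _ _ _ g f _ (within B (nbhs (g x)))); last exact: cf.
move=> W BW.
have h : \forall y \near x, A y -> B (g y) -> W (g y) := cg x Ax _ BW.
change (\forall y \near x, A y -> W (g y)).
by apply: filterS h => y h Ay; apply: (h Ay); apply: gAB; exists y.
Qed.

Lemma prod_map_cont (X Y Z : topologicalType) (S : set X) (j : X -> Z) :
  {within S, continuous j} ->
  {within S `*` [set: Y], continuous (fun x : X * Y => (j x.1, x.2))}.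
Proof.
move=> /subspace_continuousP cj; apply/subspace_continuousP => x [Sx _].
have c1 : (fun y : X * Y => j y.1) @ within (S `*` setT) (nbhs x) --> j x.1.
  move=> W /(cj _ Sx) jW.
  have h : \forall a \near x.1, S a -> W (j a) := jW.
  have h' : \forall y \near x, S y.1 -> W (j y.1) :=
    @cvg_fst _ _ (nbhs x.1) (nbhs x.2) (nbhs_filter _) _ h.
  change (\forall y \near x, (S `*` setT) y -> W (j y.1)).
  by apply: filterS h' => y /= yW [Sy _]; exact: yW.
have c2 : snd @ within (S `*` setT) (nbhs x) --> x.2.
  move=> W xW.
  have h : \forall y \near x, W y.2 :=
    @cvg_snd _ _ (nbhs x.1) (nbhs x.2) (nbhs_filter _) _ xW.
  change (\forall y \near x, (S `*` [set: Y]) y -> W y.2).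
  by apply: filterS h => y /= yW _.
exact: cvg_pair c1 c2.
Qed.

Lemma thick_map_cont (R : realType) (S S' : set (plane R))
    (j : surface_embedding S S') :
  {within S `*` setT, continuous (thick_map j)}.
Proof. exact: prod_map_cont (emb_embedding j).1. Qed.

Lemma thick_map_open (R : realType) (S S' : set (plane R))
    (j : surface_embedding S S') (V : set (space R)) :
  open V -> V `<=` S° `*` setT -> open (thick_map j @` V).
Proof.
move=> oV VS; rewrite openE => _ [[a s] Vas <-].
move: (oV); rewrite openE => /(_ _ Vas)[[A B] [/= nA nB] ABV].
have oA : open (j @` (A° `&` S°)).
  by apply: emb_open => [|x []//]; apply: openI; exact: open_interior.
exists (j @` (A° `&` S°), B) => /=.
  split=> //; move: oA; rewrite openE; apply.
  by exists a => //; split=> //; exact: (VS _ Vas).1.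
move=> [_ t] [/= [b [Ab Sb] <-] Bt]; exists (b, t) => //.
by apply: ABV; split=> //; exact: interior_subset Ab.
Qed.

Lemma thick_interior (R : realType) (S : set (plane R)) x :
  (thick S)° x -> S° x.1.
Proof.
move=> [[A B] [/= nA nB] ABS]; apply: filterS nA => a Aa.
by have [] := ABS (a, x.2) (conj Aa (nbhs_singleton nB)).
Qed.

Lemma thick_map_interior (R : realType) (S S' : set (plane R))
    (j : surface_embedding S S') x :
  (thick S)° x -> (thick S')° (thick_map j x).
Proof.
move=> Sx; have : open (thick_map j @` (thick S)°).
  apply: thick_map_open; first exact: open_interior.
  by move=> y /thick_interior.
rewrite openE => /(_ (thick_map j x)) => h.
apply: (filterS _ (h _)); last by exists x.
by move=> _ [y /interior_subset Sy <-]; exact: thick_map_thick.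
Qed.

Lemma emb_interior (R : realType) (S S' : set (plane R))
    (j : surface_embedding S S') p : S° p -> S'° (j p).
Proof.
move=> Sp; have : open (j @` S°) by apply: emb_open => //; exact: open_interior.
rewrite openE => /(_ (j p)) h; apply: (filterS _ (h _)); last by exists p.
by move=> _ [y /interior_subset Sy <-]; apply: (@emb_sub _ _ _ j); exists y.
Qed.

Lemma rail_thick_map (R : realType) (j : plane R -> plane R) p :
  thick_map j @` rail p = rail (j p).
Proof.
apply/seteqP; split=> [_ [[a s] [/= -> Is] <-] //|[a s] [/= -> Is]].
by exists (p, s).
Qed.

Lemma rail_interior (R : realType) (S : set (plane R)) p :
  S° p -> rail p `<=` S° `*` setT.
Proof. by move=> Sp [a t] [/= -> _]; split. Qed.

Lemma thick_map_sub (R : realType) (S S' : set (plane R))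
    (j : surface_embedding S S') (p q : plane R) (C : set (space R)) :
  S p -> S q ->
  C `<=` (thick S)° `\` (rail p `|` rail q) ->
  thick_map j @` C `<=` (thick S')° `\` (rail (j p) `|` rail (j q)).
Proof.
move=> Sp Sq CS _ [x /CS[Sx nx] <-]; split; first exact: thick_map_interior.
move: (interior_subset Sx) => [Sx1 _].
have inj a : S a -> rail (j a) (thick_map j x) -> rail a x.
  move=> Sa [/= ja Ix]; split=> //=.
  exact: ((emb_embedding j).2 _ _ (mem_set Sx1) (mem_set Sa) ja).
by move=> [/inj|/inj] h; apply: nx; [left|right]; exact: h.
Qed.

Lemma thick_map_embedding (R : realType) (S S' : set (plane R))
    (j : surface_embedding S S') (T : topologicalType) (A : set T)
    (g : T -> space R) :
  g @` A `<=` S `*` setT -> embedding A g -> embedding A (thick_map j \o g).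
Proof.
move=> gA [cg ig]; split; first exact: (within_comp gA cg (thick_map_cont (j := j))).
move=> x y Ax Ay /= e; apply: ig => //.
apply: (thick_map_inj (j := j)) => //; apply/mem_set/gA.
- by exists x => //; exact: set_mem.
- by exists y => //; exact: set_mem.
Qed.

Lemma thick_map_tame (R : realType) (S S' : set (plane R))
    (j : surface_embedding S S') (X : set (space R)) :
  X `<=` S° `*` setT -> tame X -> tame (thick_map j @` X).
Proof.
move=> XS [U [phi [s [[oU XU] [cphi iphi] ophi hphi Xs]]]].
pose D := S `*` [set: R]; pose U0 := U `&` (S° `*` [set: R]).
pose F := thick_map j; pose G := 'pinv_id D F.
have oS : open (S° `*` [set: R]).
  rewrite openE => x [Sx _].
  exists (S°, setT) => //=; split; last exact: filterT.
  by move: (open_interior S); rewrite openE; exact.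
have oU0 : open U0 by exact: openI.
have U0S : U0 `<=` S° `*` setT by move=> x [].
have U0D : U0 `<=` D by move=> x /U0S[/interior_subset].
have GF x : D x -> G (F x) = x.
  by move=> Dx; apply: pinvKV; [exact: thick_map_inj|exact: mem_set].
exists (F @` U0), (phi \o G), s; split.
- split; first exact: thick_map_open.
  by move=> _ [x Xx <-]; exists x => //; split; [exact: XU|exact: XS].
- split=> [_ [x Ux <-]|_ _ /set_mem[x Ux <-] /set_mem[y Uy <-]]; last first.
    rewrite /= !GF; [|exact: U0D..].
    by move=> /(iphi _ _ (mem_set Ux.1) (mem_set Uy.1)) ->.
  move=> W /=; rewrite GF; last exact: U0D.
  move=> /(cphi _ Ux.1) nW'.
  have nW : nbhs x (phi @^-1` W) := nW'.
  have nU0 : nbhs x U0 by move: oU0; rewrite openE; exact.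
  have nU : nbhs x (phi @^-1` W `&` U0) := filterI nW nU0.
  have oV : open (F @` (phi @^-1` W `&` U0)°).
    apply: (thick_map_open (open_interior _)).
    by move=> y /interior_subset[_ /U0S].
  move: oV; rewrite openE => /(_ (F x)) h.
  apply: (filterS _ (h _)); last by exists x; [exact: nU|].
  move=> _ [y /interior_subset[Wy Uy] <-] /=.
  by rewrite GF //; exact: U0D.
- move=> V oV VU.
  have -> : (phi \o G) @` V = phi @` (U0 `&` F @^-1` V).
    apply/seteqP; split=> [_ [y Vy <-]|_ [y [Uy Vy] <-]].
      have [x Ux xy] := VU _ Vy.
      by exists x; [split=> //; rewrite /= xy|rewrite /= -xy GF //; exact: U0D].
    by exists (F y) => //=; rewrite GF //; exact: U0D.
  apply: ophi; last by move=> x [[]].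
  rewrite openE => x [Ux Vx]; apply: filterI.
    by move: oU0; rewrite openE; exact.
  have /subspace_continuousP/(_ _ (U0D _ Ux)) cF := thick_map_cont (j := j).
  have nV : nbhs (F x) V by move: oV; rewrite openE; exact.
  have h1 : \forall y \near x, D y -> V (F y) := cF _ nV.
  have h2 : nbhs x U0 by move: oU0; rewrite openE; exact.
  by apply: filterS2 h1 h2 => y h /U0D /h.
- move=> _ [x Ux <-]; rewrite /= GF; last exact: U0D.
  exact: (hphi _ Ux.1).
- rewrite -Xs -image_comp; congr (phi @` _).
  rewrite image_comp; apply/seteqP; split=> [_ [x Xx <-]|x Xx].
    by rewrite /= GF //; apply: U0D; split; [exact: XU|exact: XS].
  by exists x => //=; rewrite GF //; apply: U0D; split; [exact: XU|exact: XS].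
Qed.

Lemma interior_columns (R : realType) (S : set (plane R)) :
  S° `*` [set: R] `<=` S `*` setT.
Proof. by move=> x [/interior_subset]. Qed.

Lemma closed_curve_interior (R : realType) (S : set (plane R))
    (k : multi_knotoid S) (C : set (space R)) :
  closed_curves k C -> C `<=` S° `*` setT.
Proof. by move=> /closed_curvesP[_ CS _] x /CS[/thick_interior Sx _]; split. Qed.

Lemma open_curve_interior (R : realType) (S : set (plane R))
    (k : multi_knotoid S) :
  open_curve k `<=` S° `*` setT.
Proof.
have [g [_ <- g0 g1 gS]] := open_curveP k.
move=> _ [t tI <-]; have [->|t0] := eqVneq t 0.
  exact: rail_interior (leg_rail_interior k) _ g0.
have [->|t1] := eqVneq t 1.
  exact: rail_interior (head_rail_interior k) _ g1.
have [/thick_interior//] : ((thick S)° `\` (rail (leg_rail k) `|`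
    rail (head_rail k))) (g t).
apply: gS; exists t => //; move: tI; rewrite /unit_interval /= !in_itv /=.
by rewrite !lt_neqAle t1 (eq_sym 0) t0.
Qed.

Definition multi_knotoid_image (R : realType) (S S' : set (plane R))
    (j : surface_embedding S S') (k : multi_knotoid S) : multi_knotoid S'.
Proof.
refine (@MultiKnotoid R S' (j (leg_rail k)) (j (head_rail k))
  (thick_map j @` open_curve k)
  [set thick_map j @` C | C in closed_curves k] _ _ _ _ _ _ _ _).
- exact: emb_interior (leg_rail_interior k).
- exact: emb_interior (head_rail_interior k).
- have Sp := interior_subset (leg_rail_interior k).
  have Sq := interior_subset (head_rail_interior k).
  move=> /((emb_embedding j).2 _ _ (mem_set Sp) (mem_set Sq)).
  exact: rails_disjoint.
- have [g [eg gO g0 g1 gS]] := open_curveP k.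
  exists (thick_map j \o g); split.
  + by apply: thick_map_embedding eg; rewrite gO => x /open_curve_interior/interior_columns.
  + by rewrite -gO image_comp.
  + by rewrite -rail_thick_map; exists (g 0).
  + by rewrite -rail_thick_map; exists (g 1).
  + rewrite -image_comp.
    exact: thick_map_sub (interior_subset (leg_rail_interior k))
      (interior_subset (head_rail_interior k)) gS.
- exact: finite_image (closed_curves_finite k).
- move=> _ [C kC <-]; have [[g eg gC] CS CO] := closed_curvesP kC; split.
  + exists (thick_map j \o g); last by rewrite -gC image_comp.
    apply: thick_map_embedding eg; rewrite gC => x.
    by move=> /(closed_curve_interior kC)/interior_columns.
  + exact: thick_map_sub (interior_subset (leg_rail_interior k))
      (interior_subset (head_rail_interior k)) CS.
  + rewrite -subset0 => _ [[x Cx <-] [y Oy xy]].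
    have yx : y = x.
      apply: (thick_map_inj (j := j)) xy; apply/mem_set/interior_columns.
      * exact: open_curve_interior Oy.
      * exact: (closed_curve_interior kC) Cx.
    suff : (C `&` open_curve k) x by rewrite CO.
    by split=> //; rewrite -yx.
- move=> _ _ [C kC <-] [D kD <-] [_ [[x Cx <-] [y Dy xy]]].
  have yx : y = x.
    apply: (thick_map_inj (j := j)) xy; apply/mem_set/interior_columns.
    + exact: (closed_curve_interior kD) Dy.
    + exact: (closed_curve_interior kC) Cx.
  have -> // : C = D.
  apply: (closed_curves_disjoint kC kD); exists x; split=> //=.
  by rewrite -yx.
- rewrite -!rail_thick_map bigcup_image -image_bigcup -!image_setU.
  apply: thick_map_tame; last exact: tame_diagram.
  move=> x [[[|]|]|[C kC]].
  + exact: rail_interior (leg_rail_interior k) _.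
  + exact: rail_interior (head_rail_interior k) _.
  + exact: open_curve_interior.
  + exact: (closed_curve_interior kC).
Defined.

Lemma annulus_sub_disc (R : realType) : annulus R `<=` disc R.
Proof. by move=> z /andP[]. Qed.

Lemma embedding_id (T : topologicalType) (S : set T) : embedding S (@id T).
Proof.
split; first by apply: continuous_subspaceT => x; exact: cvg_id.
by move=> x y _ _.
Qed.

Definition annulus_in_disc (R : realType) :
    surface_embedding (annulus R) (disc R).
Proof.
exists id; first exact: embedding_id.
- by rewrite image_id; exact: annulus_sub_disc.
- by move=> V oV _; rewrite image_id.
Defined.
Arguments annulus_in_disc R : clear implicits.

(* Main.v *)
(* For e an embedding of the disc in itself and p = e(0), a strong enough
   homothety s of centre p maps the disc into the interior of e(D), so that
   s = e o f for the embedding f = e^-1 o s. On isotopy classes s induces the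
   identity: move each point z of the disc towards p, by a full homothety on a
   smaller disc containing the projection of the knotoid, and less and less
   towards the boundary. Hence every e has a right inverse f on isotopy
   classes; applied to f this shows that f, and thus e, is bijective on
   classes, without the Schoenflies theorem. If j embeds the disc in the
   annulus, then rho o iota is induced by such an e, so that iota is injective
   and rho surjective. *)
Require Import Defs.
From mathcomp Require Import all_boot all_order all_algebra.
From mathcomp Require Import all_classical all_reals all_analysis.
From mathcomp Require Import ring lra.

Import Order.TTheory GRing.Theory Num.Theory.
Import numFieldNormedType.Exports.
Local Open Scope classical_set_scope.
Local Open Scope ring_scope.

(* [vector] also exports a notation of this name. *)
Local Notation space R := (R * R * R)%type.

(** * Continuity on subsets and compactness *)

Lemma within_pair (T U V : topologicalType) (A : set T) (f : T -> U)
    (g : T -> V) :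
  {within A, continuous f} -> {within A, continuous g} ->
  {within A, continuous (fun x => (f x, g x))}.
Proof.
move=> /subspace_continuousP cf /subspace_continuousP cg.
by apply/subspace_continuousP => x Ax; apply: cvg_pair; [exact: cf|exact: cg].
Qed.

Lemma within_fst (T U : topologicalType) (A : set (T * U)) :
  {within A, continuous (@fst T U)}.
Proof. by apply: continuous_subspaceT => x; exact: cvg_fst. Qed.

Lemma within_snd (T U : topologicalType) (A : set (T * U)) :
  {within A, continuous (@snd T U)}.
Proof. by apply: continuous_subspaceT => x; exact: cvg_snd. Qed.

(** The preimage under [g] of a closed [W], inside the image of [A], is the image under [f] of [A]
    intersected with [W]. That set is compact, hence closed because [U] is Hausdorff. *)
Lemma compact_inverse_continuous (T U : topologicalType) (A : set T)
    (f : T -> U) (g : U -> T) :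
  hausdorff_space U -> compact A -> {within A, continuous f} ->
  (forall x, A x -> g (f x) = x) -> {within f @` A, continuous g}.
Proof.
move=> hU cA cf gf; apply/continuous_closedP => W cW.
apply/closed_subspaceP; exists (f @` (A `&` W)).
  apply: compact_closed => //; apply: continuous_compact.
    by apply: continuous_subspaceW cf => x [].
  exact: compact_closedI.
apply/seteqP; split=> [_ [[x [Ax Wx] <-] _]|y [Wy [x Ax xy]]].
  by split; [have -> : (g @^-1` W) (f x) = W x by rewrite -{2}(gf x)|exists x].
have Wx : W x by rewrite -(gf x) // xy.
by rewrite -xy; split; exists x.
Qed.

Lemma finite_bigcup_compact (I : choiceType) (T : topologicalType) (D : set I)
    (F : I -> set T) :
  finite_set D -> (forall i, D i -> compact (F i)) ->
  compact (\bigcup_(i in D) F i).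
Proof.
move=> /finite_seqP[s ->] cF; rewrite bigcup_seq big_seq.
by apply: big_ind => [||i]; [exact: compact0|exact: compactU|exact: cF].
Qed.

Lemma compact_unit_interval (R : realType) : compact (unit_interval R).
Proof. exact: segment_compact. Qed.

Lemma compact_thick (R : realType) (S : set (plane R)) :
  compact S -> compact (thick S).
Proof.
by move=> cS; apply: compact_setX => //; exact: compact_unit_interval.
Qed.

(** * Extension of isotopies along an embedding of surfaces *)

Definition emb_inv {R : realType} {S S' : set (plane R)}
  (j : surface_embedding S S') : plane R -> plane R := 'pinv_id S j.

Lemma emb_invK {R : realType} {S S' : set (plane R)}
    (j : surface_embedding S S') p : S p -> emb_inv j (j p) = p.
Proof.
by move=> Sp; apply: pinvKV; [exact: (emb_embedding j).2|exact: mem_set].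
Qed.

Lemma emb_inv_continuous {R : realType} {S S' : set (plane R)}
    (j : surface_embedding S S') :
  compact S -> {within j @` S, continuous (emb_inv j)}.
Proof.
move=> cS; apply: compact_inverse_continuous cS _ _.
- exact: norm_hausdorff.
- exact: (emb_embedding j).1.
- by move=> p Sp; exact: emb_invK.
Qed.

Lemma thick_emb_invK {R : realType} {S S' : set (plane R)}
    (j : surface_embedding S S') x :
  thick S x -> thick_map (emb_inv j) (thick_map j x) = x.
Proof.
by case: x => p s [/= Sp _]; rewrite /thick_map /= emb_invK.
Qed.

(** Conjugation by the thickened embedding, completed by the identity. For an arbitrary [h] the two
    pieces may disagree along the boundary of the image; [extend_continuous] gives a condition under
    which they glue. *)
Definition extend {R : realType} {S S' : set (plane R)}
    (j : surface_embedding S S') (h : space R -> space R) (x : space R) :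
    space R :=
  if pselect ((thick_map j @` thick S) x)
  then thick_map j (h (thick_map (emb_inv j) x)) else x.

Lemma extend_image {R : realType} {S S' : set (plane R)}
    (j : surface_embedding S S') h x :
  thick S x -> extend j h (thick_map j x) = thick_map j (h x).
Proof.
rewrite /extend => Sx; case: pselect => [?|nx]; first by rewrite thick_emb_invK.
by exfalso; apply: nx; exists x.
Qed.

Lemma extend_out {R : realType} {S S' : set (plane R)}
    (j : surface_embedding S S') h x :
  ~ (thick_map j @` thick S) x -> extend j h x = x.
Proof. by rewrite /extend; case: pselect. Qed.

Lemma extend_comp_image {R : realType} {S S' : set (plane R)}
    (j : surface_embedding S S') h (C : set (space R)) :
  C `<=` thick S ->
  extend j h @` (thick_map j @` C) = thick_map j @` (h @` C).
Proof.
move=> CS; rewrite !image_comp; apply: eq_imagel => x /CS Sx /=.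
exact: extend_image.
Qed.

Lemma extend_bij {R : realType} {S S' : set (plane R)}
    (j : surface_embedding S S') h :
  set_bij (thick S) (thick S) h ->
  set_bij (thick S') (thick S') (extend j h).
Proof.
move=> [hS hi hs]; split.
- move=> x S'x; have [[y Sy <-]|nx] := pselect ((thick_map j @` thick S) x).
    by rewrite extend_image //; apply: thick_map_thick; exact: hS.
  by rewrite extend_out.
(* Since [h] preserves [thick S], a point of the image stays in the image, whereas a point outside
   it is fixed; the two cannot collide. *)
- have key x y : ~ (thick_map j @` thick S) x -> thick S y ->
      extend j h x <> extend j h (thick_map j y).
    move=> nx Sy; rewrite extend_out // extend_image // => xy.
    by apply: nx; exists (h y) => //; exact: hS.
  move=> x y _ _.
  have [[a Sa <-]|nx] := pselect ((thick_map j @` thick S) x);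
    have [[b Sb <-]|ny] := pselect ((thick_map j @` thick S) y).
  + rewrite !extend_image // => /(thick_map_inj (j := j)) e.
    congr thick_map; apply: hi; [exact: mem_set..|].
    by apply: e; apply: mem_set; have [] := hS _ Sa; have [] := hS _ Sb.
  + by move=> e; case: (key _ _ ny Sa).
  + by move=> e; case: (key _ _ nx Sb).
  + by rewrite !extend_out.
- move=> x S'x; have [[y Sy <-]|nx] := pselect ((thick_map j @` thick S) x).
    have [z Sz <-] := hs _ Sy; exists (thick_map j z).
      exact: thick_map_thick.
    exact: extend_image.
  by exists x => //; exact: extend_out.
Qed.

(** Two closed pieces are glued: over the image of [thick S], which is compact, the map is a
    conjugate of [H]; over the complement of the open image of [V] nothing moves. The set [V] is a
    parameter because the two kinds of move fix different parts of the boundary. *)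
Lemma extend_continuous {R : realType} {S S' : set (plane R)}
    (j : surface_embedding S S') (H : R -> space R -> space R)
    (V : set (space R)) :
  compact S -> ambient_isotopy S H ->
  open V -> V `<=` S° `*` setT ->
  (forall t x, unit_interval R t -> thick S x -> ~ V x -> H t x = x) ->
  {within unit_interval R `*` thick S',
    continuous (fun tx : R * space R => extend j (H tx.1) tx.2)}.
Proof.
move=> cS [cH bH H0] oV VS HV.
pose A := unit_interval R `*` (thick_map j @` thick S).
pose B := unit_interval R `*` ~` (thick_map j @` V).
have cI : closed (unit_interval R).
  apply: compact_closed; first exact: norm_hausdorff.
  exact: compact_unit_interval.
have cJ : compact (thick_map j @` thick S).
  apply: continuous_compact; last exact: compact_thick.
  by apply: continuous_subspaceW (thick_map_cont (j := j)) => x [].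
have cA : closed A.
  apply: compact_closed; first exact: norm_hausdorff.
  by apply: compact_setX => //; exact: compact_unit_interval.
have cB : closed B.
  have -> : B = (fst @^-1` unit_interval R) `&`
      (snd @^-1` (~` (thick_map j @` V))) by [].
  apply: closedI; apply: closed_comp => //.
  - by move=> x _; exact: cvg_fst.
  - by move=> x _; exact: cvg_snd.
  - by apply: open_closedC; exact: thick_map_open.
apply: (@continuous_subspaceW _ _ _ (A `|` B)) => [[t x] [/= It S'x]|].
  have [Jx|nJx] := pselect ((thick_map j @` thick S) x); first by left.
  (* [V] may reach beyond heights 0 and 1, but [thick_map] keeps the height, so the preimage of a
     point of [thick S'] still has its height in the unit interval. *)
  have [[y Vy yx]|] := pselect ((thick_map j @` V) x); last by right.
  left; split=> //; exists y => //; split.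
    exact: interior_subset (VS _ Vy).1.
  by case: S'x => _; rewrite -yx.
apply: withinU_continuous => //.
(* On [A] the map is a composite: pull back by the inverse embedding, apply [H], push forward
   again. *)
- have c1 : {within A, continuous (fun tx : R * space R =>
      (tx.1, thick_map (emb_inv j) tx.2))}.
    apply: within_pair; first exact: within_fst.
    apply: (@within_comp _ _ _ _ ((j @` S) `*` setT) snd); last first.
    + by apply: prod_map_cont; exact: emb_inv_continuous.
    + exact: within_snd.
    + by move=> _ [[t x] [_ [y [Sy _] <-]] <-]; split=> //; exists y.1.
  have AS : (fun tx : R * space R => (tx.1, thick_map (emb_inv j) tx.2)) @` A
      `<=` unit_interval R `*` thick S.
    move=> _ [[t x] [/= It [y Sy <-]] <-]; split=> //=.
    by rewrite thick_emb_invK.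
  have c2 := within_comp AS c1 cH.
  have c3 := within_comp _ c2 (thick_map_cont (j := j)).
  apply: subspace_eq_continuous (c3 _).
  + move=> [t x] /set_mem[/= It [y Sy <-]]; rewrite /from_subspace /=.
    by rewrite extend_image // thick_emb_invK.
  + move=> _ [[t x] [/= It [y Sy <-]] <-]; split=> //=.
    rewrite thick_emb_invK //.
    by have [hS _ _] := bH _ It; have [] := hS _ Sy.
- apply: (@subspace_eq_continuous _ _ _ snd); last exact: within_snd.
  move=> [t x] /set_mem[/= It nVx]; rewrite /from_subspace /=.
  have [[y Sy yx]|nx] := pselect ((thick_map j @` thick S) x).
    rewrite -yx extend_image // HV // => Vy.
    by apply: nVx; exists y.
  by rewrite extend_out.
Qed.

Lemma extend_ambient_isotopy {R : realType} {S S' : set (plane R)}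
    (j : surface_embedding S S') (H : R -> space R -> space R)
    (V : set (space R)) :
  compact S -> ambient_isotopy S H ->
  open V -> V `<=` S° `*` setT ->
  (forall t x, unit_interval R t -> thick S x -> ~ V x -> H t x = x) ->
  ambient_isotopy S' (fun t => extend j (H t)).
Proof.
move=> cS iH oV VS HV; split.
- exact: extend_continuous VS HV.
- by move=> t It; apply: extend_bij; case: iH => _ + _; exact.
- move=> x S'x; have [[y Sy <-]|nx] := pselect ((thick_map j @` thick S) x).
    by rewrite extend_image //; case: iH => _ _ ->.
  exact: extend_out.
Qed.

Lemma open_curve_thick {R : realType} {S : set (plane R)}
    (k : multi_knotoid S) : open_curve k `<=` thick S.
Proof.
have [g [_ <- g0 g1 gS]] := open_curveP k.
have Sl := interior_subset (leg_rail_interior k).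
have Sh := interior_subset (head_rail_interior k).
move=> _ [t tI <-]; have [->|t0] := eqVneq t 0.
  by case: g0 => e I0; split=> //; rewrite e.
have [->|t1] := eqVneq t 1.
  by case: g1 => e I1; split=> //; rewrite e.
suff [/interior_subset] : ((thick S)° `\` (rail (leg_rail k) `|`
    rail (head_rail k))) (g t) by [].
apply: gS; exists t => //; move: tI; rewrite /unit_interval /= !in_itv /=.
by rewrite !lt_neqAle t1 (eq_sym 0) t0.
Qed.

Lemma closed_curve_thick {R : realType} {S : set (plane R)}
    (k : multi_knotoid S) C : closed_curves k C -> C `<=` thick S.
Proof. by move=> /closed_curvesP[_ CS _] x /CS[/interior_subset]. Qed.

Lemma rail_thick {R : realType} {S : set (plane R)} p :
  S p -> rail p `<=` thick S.
Proof. by move=> Sp [a s] [/= -> Is]. Qed.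

Lemma carries_curves_extend {R : realType} {S S' : set (plane R)}
    (j : surface_embedding S S') h (k k' : multi_knotoid S) :
  carries_curves h k k' ->
  carries_curves (extend j h) (multi_knotoid_image j k)
    (multi_knotoid_image j k').
Proof.
move=> [ho hc]; split=> /=.
  by rewrite extend_comp_image ?ho //; exact: open_curve_thick.
rewrite hc !image_comp; apply: eq_imagel => C kC /=.
by rewrite extend_comp_image //; exact: closed_curve_thick kC.
Qed.

(** The isotopy fixes the whole boundary of [thick S], top and bottom included, so its support lies
    in the interior, which serves as [V]. The extension fixes the boundary of [thick S'] because
    [thick_map j] sends interior points to interior points. *)
Lemma rail_fixing_isotopic_image {R : realType} {S S' : set (plane R)}
    (j : surface_embedding S S') (k k' : multi_knotoid S) :
  compact S -> rail_fixing_isotopic k k' ->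
  rail_fixing_isotopic (multi_knotoid_image j k) (multi_knotoid_image j k').
Proof.
move=> cS [H [iH fH rH [lk hk] cH]]; exists (fun t => extend j (H t)).
have Sl := interior_subset (leg_rail_interior k).
have Sh := interior_subset (head_rail_interior k).
split.
- apply: (@extend_ambient_isotopy _ _ _ _ _ (thick S)°) => //.
  + exact: open_interior.
  + by move=> x /thick_interior.
  + by move=> t x It Sx nx; exact: fH.
- move=> t x It [S'x nx].
  have [[y Sy yx]|] := pselect ((thick_map j @` thick S) x); last first.
    exact: extend_out.
  rewrite -yx extend_image // fH //; split=> // y_int.
  by apply: nx; rewrite -yx; exact: thick_map_interior.
- move=> t It; have [rl rh] := rH _ It.
  rewrite /= -!rail_thick_map !extend_comp_image ?rl ?rh //;
    exact: rail_thick.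
- by rewrite /= lk hk.
- exact: carries_curves_extend.
Qed.

(** A shift may move the top and bottom faces and is only known to fix the columns over the boundary
    of [S]. Hence [V] consists of the full vertical lines over the interior of [S], which is open
    even though its intersection with the slab is not. *)
Lemma rail_shift_image {R : realType} {S S' : set (plane R)}
    (j : surface_embedding S S') (k k' : multi_knotoid S) :
  compact S -> rail_shift k k' ->
  rail_shift (multi_knotoid_image j k) (multi_knotoid_image j k').
Proof.
move=> cS [H [p [q [iH fH rH [lk hk] cH]]]].
exists (fun t => extend j (H t)), (j \o p), (j \o q).
have Sl := interior_subset (leg_rail_interior k).
have Sh := interior_subset (head_rail_interior k).
split.
- apply: (@extend_ambient_isotopy _ _ _ _ _ (S° `*` setT)) => //.
  + have -> : S° `*` setT = fst @^-1` S° :> set (space R).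
      by apply/seteqP; split=> x //= [].
    apply: open_comp => [x _|]; [exact: cvg_fst|exact: open_interior].
  + move=> t x It [Sx Ix] nx; apply: fH => //; split=> //.
    by split=> // ?; apply: nx.
- move=> t x It [[S'x nx] Ix].
  have [[y Sy yx]|] := pselect ((thick_map j @` thick S) x); last first.
    exact: extend_out.
  rewrite -yx extend_image // fH //; case: Sy => Sy Iy; split=> //.
  split=> // y_int.
  by apply: nx; rewrite -yx; exact: emb_interior.
- move=> t It; have [rl rh] := rH _ It.
  rewrite /= -![rail (j _)]rail_thick_map !extend_comp_image ?rl ?rh //;
    exact: rail_thick.
- by rewrite /= lk hk.
- exact: carries_curves_extend.
Qed.

Lemma rail_isotopic_image {R : realType} {S S' : set (plane R)}
    (j : surface_embedding S S') (k k' : multi_knotoid S) :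
  compact S -> rail_isotopic k k' ->
  rail_isotopic (multi_knotoid_image j k) (multi_knotoid_image j k').
Proof.
move=> cS; elim=> [a b [ab|ab]|a|a b _ ba|a b c _ ab _ bc].
- apply: Relation_Operators.rst_step; left.
  exact: rail_fixing_isotopic_image.
- by apply: Relation_Operators.rst_step; right; exact: rail_shift_image.
- exact: Relation_Operators.rst_refl.
- exact: Relation_Operators.rst_sym.
- exact: Relation_Operators.rst_trans ab bc.
Qed.

(** * Equality of multi-knotoids and of their classes *)

Lemma multi_knotoid_eq {R : realType} {S : set (plane R)}
    (k k' : multi_knotoid S) :
  leg_rail k = leg_rail k' -> head_rail k = head_rail k' ->
  open_curve k = open_curve k' -> closed_curves k = closed_curves k' -> k = k'.
Proof.
case: k => l h o c p1 p2 p3 p4 p5 p6 p7 p8.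
case: k' => l' h' o' c' q1 q2 q3 q4 q5 q6 q7 q8 /= el eh eo ec.
by subst l' h' o' c'; congr MultiKnotoid; exact: Prop_irrelevance.
Qed.

Lemma knotoid_classE {R : realType} {S : set (plane R)}
    (k k' : multi_knotoid S) :
  knotoid_class k = knotoid_class k' <-> rail_isotopic k k'.
Proof.
split=> [/eqquotP/asboolP //|kk'].
by apply/eqquotP/asboolP.
Qed.

(** * Homotheties and the topology of the disc *)

Definition sqnorm {R : realType} (z : plane R) : R := z.1 ^+ 2 + z.2 ^+ 2.

(** The homothety of centre [p] and ratio [1 - a]: the identity for [a = 0], the constant [p] for
    [a = 1], an expansion for negative [a]. *)
Definition toward {R : realType} (p : plane R) (a : R) (z : plane R) :
    plane R :=
  ((1 - a) * z.1 + a * p.1, (1 - a) * z.2 + a * p.2).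

Lemma toward0 {R : realType} (p : plane R) z : toward p 0 z = z.
Proof. by case: z => x y; rewrite /toward /= subr0 !mul1r !mul0r !addr0. Qed.

(** Convexity of the squared norm; the defect is [a * (1 - a)] times the squared distance from [z]
    to [p]. *)
Lemma sqnorm_toward {R : realType} (p : plane R) a z :
  0 <= a <= 1 -> sqnorm (toward p a z) <= (1 - a) * sqnorm z + a * sqnorm p.
Proof.
case: p z => p q [x y] /andP[a0 a1]; rewrite /sqnorm /toward /= -subr_ge0.
have -> : (1 - a) * (x ^+ 2 + y ^+ 2) + a * (p ^+ 2 + q ^+ 2) -
    (((1 - a) * x + a * p) ^+ 2 + ((1 - a) * y + a * q) ^+ 2) =
    a * (1 - a) * ((x - p) ^+ 2 + (y - q) ^+ 2) by ring.
by rewrite mulr_ge0 ?addr_ge0 ?sqr_ge0 // mulr_ge0 // subr_ge0.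
Qed.

Lemma sqnorm_continuous {R : realType} : continuous (@sqnorm R).
Proof.
move=> z; rewrite /sqnorm; apply: cvgD; rewrite -?expr2.
- by apply: cvgM; exact: cvg_fst.
- by apply: cvgM; exact: cvg_snd.
Qed.

Lemma toward_cvg {R : realType} (T : topologicalType) (p : plane R)
    (a : T -> R) (f : T -> plane R) (x : T) :
  {for x, continuous a} -> {for x, continuous f} ->
  {for x, continuous (fun y => toward p (a y) (f y))}.
Proof.
move=> ca cf.
have cb : {for x, continuous (fun y => 1 - a y)}.
  by apply: cvgB; [exact: cvg_cst|exact: ca].
have c1 : {for x, continuous (fun y => (f y).1)} .
  by apply: (cvg_comp _ _ cf); exact: cvg_fst.
have c2 : {for x, continuous (fun y => (f y).2)} .
  by apply: (cvg_comp _ _ cf); exact: cvg_snd.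
have ck (c : R) : {for x, continuous (fun y => a y * c)}.
  by apply: continuousM ca _; exact: cvg_cst.
exact: cvg_pair (continuousD (continuousM cb c1) (ck p.1))
  (continuousD (continuousM cb c2) (ck p.2)).
Qed.

Lemma toward_continuous {R : realType} (p : plane R) a :
  continuous (toward p a).
Proof.
move=> z.
by apply: (@toward_cvg _ _ _ (fun=> a) id); [exact: cvg_cst|exact: cvg_id].
Qed.

Lemma compact_square {R : realType} :
  compact (`[-1, 1]%classic `*` `[-1, 1]%classic : set (plane R)).
Proof. by apply: compact_setX; exact: segment_compact. Qed.

Lemma disc_square {R : realType} :
  disc R `<=` `[-1, 1]%classic `*` `[-1, 1]%classic.
Proof.
move=> [x y]; rewrite /disc /= => xy1.
by split; rewrite in_itv /=; apply/andP; nra.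
Qed.

Lemma closed_sqnorm_le {R : realType} (c : R) :
  closed [set z : plane R | sqnorm z <= c].
Proof.
apply: (@closed_comp _ _ (@sqnorm R) [set x | x <= c]); last exact: closed_le.
by move=> z _; exact: sqnorm_continuous.
Qed.

Lemma closed_sqnorm_ge {R : realType} (c : R) :
  closed [set z : plane R | c <= sqnorm z].
Proof.
apply: (@closed_comp _ _ (@sqnorm R) [set x | c <= x]); last exact: closed_ge.
by move=> z _; exact: sqnorm_continuous.
Qed.

Lemma compact_disc {R : realType} : compact (disc R).
Proof.
exact: subclosed_compact (closed_sqnorm_le 1) compact_square disc_square.
Qed.

Lemma compact_annulus {R : realType} : compact (annulus R).
Proof.
have -> : annulus R = [set z | 1 / 4 <= sqnorm z] `&` [set z | sqnorm z <= 1].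
  by apply/seteqP; split=> z /= => [/andP[]|[? ?]]; last apply/andP.
apply: subclosed_compact compact_disc _ => [|z []//].
by apply: closedI; [exact: closed_sqnorm_ge|exact: closed_sqnorm_le].
Qed.

Lemma compact_unit_circle {R : realType} : compact (unit_circle R).
Proof.
have -> : unit_circle R = [set z | 1 <= sqnorm z] `&` [set z | sqnorm z <= 1].
  apply/seteqP; split=> z; rewrite /unit_circle /sqnorm /=; first by move=> ->.
  by move=> [? ?]; apply/eqP; rewrite eq_le; apply/andP.
apply: subclosed_compact compact_disc _ => [|z []//].
by apply: closedI; [exact: closed_sqnorm_ge|exact: closed_sqnorm_le].
Qed.

Lemma disc_interior {R : realType} :
  (disc R)° = [set z | sqnorm z < 1].
Proof.
apply/seteqP; split=> z.
- move=> dz; rewrite /= ltNge; apply/negP => z1.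
  (* pushing [z] outwards leaves the disc *)
  have : toward 0 t z @[t --> (0 : R)^'-] --> z.
    rewrite -{2}(toward0 0 z).
    apply: (@cvg_at_left_filter _ _ (fun t => toward 0 t z) 0).
    by apply: (@toward_cvg _ _ 0 id (fun=> z));
    [exact: cvg_id|exact: cvg_cst].
  move=> /(_ _ dz) /= h.
  have h0 : \forall t \near (0 : R)^'-, t < 0 by exact: nbhs_left_lt.
  have [t [t0 dt]] := filter_ex (filterI h0 h).
  move: dt z1; rewrite /disc /sqnorm /toward /= !mulr0 !addr0 => dt z1.
  have : 1 < (1 - t) ^+ 2 by nra.
  nra.
- move=> /= z1; apply: (@filterS _ _ _ [set z | sqnorm z < 1]).
    by move=> w; exact: ltW.
  apply: open_nbhs_nbhs; split => //.
  apply: (@open_comp _ _ (@sqnorm R) [set x | x < 1]); last exact: open_lt.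
  by move=> ? _; exact: sqnorm_continuous.
Qed.

(** The squared norm attains its maximum on a nonempty compact set, at a point of the open disc, so
    the maximum itself is below 1. *)
Lemma sqnorm_bound {R : realType} (A : set (plane R)) :
  compact A -> A `<=` (disc R)° ->
  exists2 m : R, m < 1 & forall z, A z -> sqnorm z <= m.
Proof.
move=> cA; rewrite disc_interior => A1.
have [[z0 Az0]|] := pselect (A !=set0); last first.
  move=> nA; exists 0; first exact: ltr01.
  by move=> z Az; case: nA; exists z.
have [||c cin cmax] := @compact_EVT_max _ R (@sqnorm R) A _ cA.
- by exists z0.
- exact/continuous_subspaceT/sqnorm_continuous.
exists (sqnorm c); first exact/A1/set_mem.
by move=> z Az; apply: cmax; exact: mem_set.
Qed.

(** * The projection of a multi-knotoid to the surface *)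

Lemma open_curve_compact {R : realType} {S : set (plane R)}
    (k : multi_knotoid S) : compact (open_curve k).
Proof.
have [g [[cg _] <- _ _ _]] := open_curveP k.
exact: continuous_compact cg (@compact_unit_interval R).
Qed.

Lemma closed_curve_compact {R : realType} {S : set (plane R)}
    (k : multi_knotoid S) C : closed_curves k C -> compact C.
Proof.
move=> /closed_curvesP[[g [cg _] <-] _ _].
exact: continuous_compact cg compact_unit_circle.
Qed.

(** Being compact and contained in the interior, this set leaves a collar along the boundary of the
    disc in which a homothety can fade to the identity. *)
Definition shadow {R : realType} {S : set (plane R)} (k : multi_knotoid S) :
    set (plane R) :=
  fst @` (open_curve k `|` \bigcup_(C in closed_curves k) C) `|`
  [set leg_rail k; head_rail k].

Lemma shadow_compact {R : realType} {S : set (plane R)}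
    (k : multi_knotoid S) : compact (shadow k).
Proof.
apply: compactU; last by apply: finite_compact; exact: finite_set2.
apply: continuous_compact; first exact: within_fst.
apply: compactU; first exact: open_curve_compact.
apply: finite_bigcup_compact; first exact: closed_curves_finite.
exact: closed_curve_compact.
Qed.

Lemma shadow_interior {R : realType} {S : set (plane R)}
    (k : multi_knotoid S) : shadow k `<=` S°.
Proof.
move=> z [[x xk <-]|[]->]; last 2 first.
- exact: leg_rail_interior.
- exact: head_rail_interior.
by case: xk => [/open_curve_interior|[C kC /(closed_curve_interior kC)]] [].
Qed.

(** * Homotheties fading out towards the boundary circle *)

Lemma toward_toward {R : realType} (p : plane R) a b z :
  toward p a (toward p b z) = toward p (1 - (1 - a) * (1 - b)) z.
Proof. by congr pair; rewrite /toward /=; ring. Qed.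

(** Ratios multiply under composition, and the parameter [- (a / (1 - a))] is the one of ratio
    [1 / (1 - a)]. *)
Lemma towardK {R : realType} (p : plane R) a :
  a < 1 -> cancel (toward p a) (toward p (- (a / (1 - a)))).
Proof.
move=> a1 z; rewrite toward_toward.
have -> : 1 - (1 - - (a / (1 - a))) * (1 - a) = 0 by field; lra.
exact: toward0.
Qed.

Lemma towardVK {R : realType} (p : plane R) a :
  a < 1 -> cancel (toward p (- (a / (1 - a)))) (toward p a).
Proof.
move=> a1 z; rewrite toward_toward.
have -> : 1 - (1 - a) * (1 - - (a / (1 - a))) = 0 by field; lra.
exact: toward0.
Qed.

Lemma toward_open {R : realType} (p : plane R) a (V : set (plane R)) :
  a < 1 -> open V -> open (toward p a @` V).
Proof.
move=> a1 oV.
have -> : toward p a @` V = toward p (- (a / (1 - a))) @^-1` V.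
  apply/seteqP; split=> [_ [z Vz <-]|z Vz]; first by rewrite /= towardK.
  by exists (toward p (- (a / (1 - a))) z) => //; rewrite towardVK.
by apply: open_comp => // z _; exact: toward_continuous.
Qed.

(** A cut-off function: 1 on the core [sqnorm z <= m], then affine in [sqnorm] down to 0 on the unit
    circle. *)
Definition weight {R : realType} (m : R) (z : plane R) : R :=
  (1 - Num.max m (sqnorm z)) / (1 - m).

Lemma weight_le1 {R : realType} (m : R) z : m < 1 -> weight m z <= 1.
Proof.
move=> m1; rewrite /weight ler_pdivrMr ?subr_gt0 // mul1r lerD2l lerN2.
by rewrite le_max lexx.
Qed.

Lemma weight_ge0 {R : realType} (m : R) z :
  m < 1 -> disc R z -> 0 <= weight m z.
Proof.
move=> m1 dz; rewrite /weight divr_ge0 ?subr_ge0 ?(ltW m1) //.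
by rewrite ge_max (ltW m1).
Qed.

Lemma weight_in {R : realType} (m : R) z :
  m < 1 -> sqnorm z <= m -> weight m z = 1.
Proof.
by move=> m1 zm; rewrite /weight max_l // divff // subr_eq0 eq_sym lt_eqF.
Qed.

Lemma weight_boundary {R : realType} (m : R) z :
  m < 1 -> (disc R `\` (disc R)°) z -> weight m z = 0.
Proof.
move=> m1 [dz]; rewrite disc_interior /= => /negP; rewrite -leNgt => z1.
have e : sqnorm z = 1 by apply/eqP; rewrite eq_le z1 andbT.
by rewrite /weight e max_r ?subrr ?mul0r // ltW.
Qed.

Lemma weight_lt {R : realType} (m : R) z w : m < 1 ->
  weight m w < weight m z -> sqnorm z < sqnorm w /\ m < sqnorm w.
Proof.
move=> m1; rewrite /weight ltr_pM2r ?invr_gt0 ?subr_gt0 //.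
rewrite ltrD2l ltrN2 lt_max !gt_max ltxx /=.
by move=> /andP[-> ->].
Qed.

Lemma weight_continuous {R : realType} (m : R) : continuous (weight m).
Proof.
move=> z; apply: cvgM; last exact: cvg_cst.
apply: cvgB; first exact: cvg_cst.
apply: continuous_max; first exact: cvg_cst.
exact: sqnorm_continuous.
Qed.

(** Injectivity: at equal parameters a homothety is injective, and at different ones a coincidence
    would contradict convexity of the squared norm. Surjectivity comes from the intermediate value
    theorem in the parameter of the homothety. *)
Lemma squeeze_bij {R : realType} (p : plane R) (c m : R) :
  0 <= c < 1 -> m < 1 -> sqnorm p <= m ->
  set_bij (disc R) (disc R) (fun z => toward p (c * weight m z) z).
Proof.
move=> /andP[c0 c1] m1 pm.
have bnd z : disc R z -> 0 <= c * weight m z < 1.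
  move=> dz; rewrite mulr_ge0 ?weight_ge0 //=.
  apply: le_lt_trans c1; rewrite -[leRHS]mulr1 ler_wpM2l //; exact: weight_le1.
have inj z w : disc R z -> disc R w -> c * weight m w < c * weight m z ->
    toward p (c * weight m z) z <> toward p (c * weight m w) w.
  move=> dz dw wz e.
  have /andP[a0 a1] := bnd _ dz; have /andP[b0 b1] := bnd _ dw.
  move: a0 a1 b0 b1 wz e.
  set a := c * weight m z; set b := c * weight m w => a0 a1 b0 b1 ba e.
  have [zw mw] : sqnorm z < sqnorm w /\ m < sqnorm w.
    apply: weight_lt => //; rewrite -(@ltr_pM2l _ c) // lt_def c0 andbT.
    by apply: contraTN ba => /eqP cE; rewrite /a /b cE !mul0r ltxx.
  have := towardK p b b1 w; rewrite -e toward_toward.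
  set d := 1 - _ => dE.
  have dab : d = (a - b) / (1 - b) by rewrite /d; field; lra.
  have d0 : 0 < d by rewrite dab divr_gt0 ?subr_gt0.
  have d1 : d < 1 by rewrite dab ltr_pdivrMr ?subr_gt0 // mul1r ltrD2r.
  (* [w] lies strictly between [z] and [p], both of smaller norm *)
  have := @sqnorm_toward _ p d z; rewrite dE (ltW d0) (ltW d1) => /(_ isT).
  nra.
split.
- move=> z dz; have /andP[a0 a1] := bnd _ dz.
  have := @sqnorm_toward _ p (c * weight m z) z; rewrite a0 (ltW a1).
  move=> /(_ isT) h; apply: (le_trans h).
  have : sqnorm z <= 1 by [].
  nra.
- move=> z w /set_mem dz /set_mem dw e.
  have [wz|zw|ab] := ltgtP (c * weight m w) (c * weight m z).
  + by case: (inj _ _ dz dw wz).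
  + by case: (inj _ _ dw dz zw).
  + have /andP[_ b1] := bnd _ dw; apply: (can_inj (towardK p _ b1)).
    by rewrite -e ab.
(* The only candidate preimage of [y] with parameter [a] is [u a]; it is one exactly when its own
   parameter [c * weight m (u a)] equals [a], that is, when [f a = 0]. *)
- move=> y dy; pose u (a : R) := toward p (- (a / (1 - a))) y.
  pose f (a : R) := c * weight m (u a) - a.
  have cf : {within `[0, c], continuous f}.
    apply: continuous_in_subspaceT => a /set_mem.
    rewrite /= in_itv /= => /andP[a0 ac].
    have a1 : 1 - a != 0 by rewrite subr_eq0 gt_eqF // (le_lt_trans ac).
    have cV : {for a, continuous (fun b : R => (1 - b)^-1)}.
      by apply: cvgV => //; apply: cvgB; [exact: cvg_cst|exact: cvg_id].
    have cN : {for a, continuous (fun b : R => - (b / (1 - b)))}.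
      by apply: continuousN; apply: continuousM cV; exact: cvg_id.
    have cu : {for a, continuous u}.
      by apply: toward_cvg cN _; exact: cvg_cst.
    have cw : {for a, continuous (fun b => weight m (u b))}.
      exact: (@continuous_comp _ _ _ u (weight m) a cu
        (weight_continuous m (u a))).
    have cm : {for a, continuous (fun b => c * weight m (u b))}.
      by apply: cvgM cw; exact: cvg_cst.
    by apply: cvgB cm _; exact: cvg_id.
  have f0 : 0 <= f 0.
    rewrite /f /u mul0r oppr0 toward0 addr0 mulr_ge0 //; exact: weight_ge0.
  have fc : f c <= 0.
    by rewrite /f subr_le0 -[leRHS]mulr1 ler_wpM2l //; exact: weight_le1.
  have [|a] := @IVT _ f 0 c 0 c0 cf.
    by rewrite ge_min le_max f0 fc orbT.
  rewrite in_itv /= => /andP[a0 ac] /eqP; rewrite subr_eq0 => /eqP fa.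
  have a1 : a < 1 by apply: le_lt_trans c1.
  exists (u a); last by rewrite fa /u towardVK.
  (* The candidate must still be shown to lie in the disc. For [a = 0] it is [y]; for [a > 0] its
     weight is positive, which forces its squared norm below 1. *)
  move: a0; rewrite le_eqVlt => /orP[/eqP a0|a0].
    by rewrite /u -a0 mul0r oppr0 toward0.
  have : 0 < weight m (u a).
    rewrite ltNge; apply/negP => w0; move: a0; rewrite -fa.
    by rewrite ltNge mulr_ge0_le0.
  rewrite /weight pmulr_lgt0 ?invr_gt0 ?subr_gt0 // gt_max => /andP[_].
  exact: ltW.
Qed.

(** * Self-embeddings of the disc acting on isotopy classes *)

Lemma thick_map_bij {R : realType} (S : set (plane R))
    (h : plane R -> plane R) :
  set_bij S S h -> set_bij (thick S) (thick S) (thick_map h).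
Proof.
move=> [hS hi hs]; split.
- by move=> x [Sx Ix]; split=> //; exact: hS.
- move=> [a s] [b t] /set_mem[/= Sa _] /set_mem[/= Sb _] [/= ab ->].
  by rewrite (hi _ _ (mem_set Sa) (mem_set Sb) ab).
- move=> [a s] [/= Sa Is]; have [b Sb <-] := hs _ Sa.
  by exists (b, s).
Qed.

(** The fading homothety, with its parameter scaled by [t], is a rail shift: it keeps heights,
    carries rails to parallel rails and fixes the columns over the boundary circle. At [t = 1] it
    agrees with [e] after [f] on the shadow, where the weight is 1, and the curves and rails see
    nothing else. *)
Lemma shrink_isotopic {R : realType} (e f : surface_embedding (disc R) (disc R))
    (p : plane R) (d : R) (k : multi_knotoid (disc R)) :
  (disc R)° p -> 0 <= d < 1 ->
  (forall z, disc R z -> e (f z) = toward p d z) ->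
  rail_isotopic k (multi_knotoid_image e (multi_knotoid_image f k)).
Proof.
move=> dp /andP[d0 d1] ef.
(* The centre [p] is added to the shadow so that it lies in the core as well, as [squeeze_bij]
   requires. *)
have [||m m1 km] := @sqnorm_bound _ (shadow k `|` [set p]).
- by apply: compactU; [exact: shadow_compact|exact: compact_set1].
- by move=> z [/shadow_interior|->].
have pm : sqnorm p <= m by apply: km; right.
pose h t z := toward p (t * d * weight m z) z.
have hE z : shadow k z -> h 1 z = e (f z).
  move=> kz; rewrite /h mul1r weight_in ?mulr1 ?ef //; last by apply: km; left.
  exact: interior_subset (shadow_interior _ _ kz).
have himage (C : set (space R)) : fst @` C `<=` shadow k ->
    thick_map (h 1) @` C = thick_map e @` (thick_map f @` C).
  move=> Ck; rewrite image_comp; apply: eq_imagel => x Cx.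
  by rewrite /thick_map /= hE //; apply: Ck; exists x.
apply: Relation_Operators.rst_step; right.
exists (fun t => thick_map (h t)), (h^~ (leg_rail k)), (h^~ (head_rail k)).
split.
- split.
  + apply: continuous_subspaceT => -[t x].
    have c1 : {for (t, x), continuous (fun tx : R * space R => tx.2.1)}.
      by apply: (cvg_comp _ _ cvg_snd); exact: cvg_fst.
    have c2 : {for (t, x), continuous (fun tx : R * space R => tx.2.2)}.
      by apply: (cvg_comp _ _ cvg_snd); exact: cvg_snd.
    have cw : {for (t, x),
        continuous (fun tx : R * space R => weight m tx.2.1)}.
      exact: (@continuous_comp _ _ _ _ (weight m) _ c1
        (weight_continuous m x.1)).
    have ct : {for (t, x), continuous (fun tx : R * space R => tx.1 * d)}.
      by apply: cvgM; [exact: cvg_fst|exact: cvg_cst].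
    exact: cvg_pair (toward_cvg _ p _ _ _ (continuousM ct cw) c1) c2.
  + move=> t; rewrite /unit_interval /= in_itv /= => /andP[t0 t1].
    apply: thick_map_bij; apply: squeeze_bij => //.
    by apply/andP; split; nra.
  + by move=> [z s] _; rewrite /thick_map /h /= !mul0r toward0.
- move=> t [z s] _ [/= zb _].
  by rewrite /thick_map /h /= weight_boundary // mulr0 toward0.
- by move=> t _; rewrite !rail_thick_map.
- by split; rewrite /= -hE //; right; [left|right].
- split=> /=.
  + by rewrite himage // => _ [x Ox <-]; left; exists x => //; left.
  + rewrite image_comp; apply: eq_imagel => C kC; rewrite /= himage //.
    by move=> _ [x Cx <-]; left; exists x => //; right; exists C.
Qed.

Lemma shrink_factor {R : realType} (e : surface_embedding (disc R) (disc R)) :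
  exists (f : surface_embedding (disc R) (disc R)) (p : plane R) (d : R),
  [/\ (disc R)° p, 0 <= d < 1 &
      forall z, disc R z -> e (f z) = toward p d z].
Proof.
pose p := e (0, 0).
have d0 : (disc R)° (0, 0).
  by rewrite disc_interior /sqnorm /= !expr0n /= addr0 ltr01.
have dp : (disc R)° p by exact: emb_interior.
have [r /= r0 rE] : exists2 r : R, 0 < r & ball p r `<=` e @` (disc R)°.
  apply/nbhs_ballP; apply: open_nbhs_nbhs; split; last by exists (0, 0).
  by apply: emb_open => //; exact: open_interior.
(* The ratio [r / (r + 4)] is below 1, and its double is below [r]. Balls of the product are
   squares, and coordinates of points of the disc differ by at most 2, so the homothety brings the
   disc into the ball of radius [r] about [p]. *)
pose d := 1 - r / (r + 4).
have r4 : 0 < r + 4 by lra.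
have rr1 : r / (r + 4) < 1 by rewrite ltr_pdivrMr // mul1r ltrDl.
have rr0 : 0 < r / (r + 4) by rewrite divr_gt0.
have rr : r / (r + 4) * 2 < r.
  by rewrite mulrAC ltr_pdivrMr // ltr_pM2l //; lra.
have d1 : d < 1 by rewrite /d gtrBl.
have te z : disc R z -> (e @` (disc R)°) (toward p d z).
  move=> /disc_square[]; rewrite /= !in_itv /= => zx zy; apply: rE.
  have := interior_subset dp.
  move=> /disc_square[]; rewrite /= !in_itv /= => px py.
  have key (a b : R) : -1 <= a <= 1 -> -1 <= b <= 1 ->
      `|b - ((1 - d) * a + d * b)| < r.
    move=> a1 b1; have -> : b - ((1 - d) * a + d * b) = r / (r + 4) * (b - a).
      by rewrite /d; ring.
    rewrite normrM (gtr0_norm rr0); apply: le_lt_trans rr.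
    by rewrite ler_pM2l // ler_norml; lra.
  by split; apply: key.
have fE z : disc R z -> (disc R)° (emb_inv e (toward p d z)) /\
    e (emb_inv e (toward p d z)) = toward p d z.
  by move=> /te[y dy <-]; rewrite emb_invK //; exact: interior_subset.
have femb : embedding (disc R) (emb_inv e \o toward p d).
  split.
  - apply: (@within_comp _ _ _ _ (e @` disc R)).
    + by move=> _ [z /te[y /interior_subset dy yz] <-]; exists y.
    + exact/continuous_subspaceT/toward_continuous.
    + exact: emb_inv_continuous compact_disc.
  - move=> z w /set_mem dz /set_mem dw /= zw.
    apply: (can_inj (towardK p _ d1)).
    by rewrite -(fE _ dz).2 zw (fE _ dw).2.
have fsub : (emb_inv e \o toward p d) @` disc R `<=` disc R.
  by move=> _ [z /fE[/interior_subset] ? _ <-].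
have fopen V : open V -> V `<=` (disc R)° ->
    open ((emb_inv e \o toward p d) @` V).
  move=> oV Vd.
  have -> : (emb_inv e \o toward p d) @` V =
      (disc R)° `&` e @^-1` (toward p d @` V).
    apply/seteqP; split=> [_ [z Vz <-]|y [dy [z Vz zy]]].
      have [dz ez] := fE _ (interior_subset (Vd _ Vz)).
      by split=> //; exists z.
    by exists z => //=; rewrite zy emb_invK //; exact: interior_subset.
  have oW := toward_open p _ _ d1 oV.
  rewrite openE => y [dy Wy].
  have /subspace_continuousP/(_ _ (interior_subset dy)) ce :=
    (emb_embedding e).1.
  have nW : nbhs (e y) (toward p d @` V) by move: oW; rewrite openE; exact.
  have h1 : \forall z \near y, disc R z -> (toward p d @` V) (e z) := ce _ nW.
  have h2 : nbhs y (disc R)°.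
    by move: (open_interior (disc R)); rewrite openE; exact.
  apply: filterS2 h1 h2 => z h dz; split=> //.
  by apply: h; exact: interior_subset.
exists (SurfaceEmbedding femb fsub fopen), p, d; split => //.
- by rewrite d1 andbT /d subr_ge0 ltW.
- by move=> z /fE[].
Qed.

Lemma image_section {R : realType} (e : surface_embedding (disc R) (disc R)) :
  exists f : surface_embedding (disc R) (disc R),
  forall k, rail_isotopic k (multi_knotoid_image e (multi_knotoid_image f k)).
Proof.
have [f [p [d [dp d01 ef]]]] := shrink_factor e.
by exists f => k; exact: shrink_isotopic ef.
Qed.

(** A right inverse [f] of [e] on classes has in turn a right inverse [g]. Associativity makes [g]
    and [e] agree on classes, so [f] is also a left inverse of [e]. *)
Lemma rail_isotopic_image_inj {R : realType}
    (e : surface_embedding (disc R) (disc R)) (k k' : multi_knotoid (disc R)) :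
  rail_isotopic (multi_knotoid_image e k) (multi_knotoid_image e k') ->
  rail_isotopic k k'.
Proof.
have [f ef] := image_section e; have [g fg] := image_section f.
have symm (a b : multi_knotoid (disc R)) :
    rail_isotopic a b -> rail_isotopic b a.
  exact: Relation_Operators.rst_sym.
have trans (a b c : multi_knotoid (disc R)) :
    rail_isotopic a b -> rail_isotopic b c -> rail_isotopic a c.
  exact: Relation_Operators.rst_trans.
have im (h : surface_embedding (disc R) (disc R)) a b :
    rail_isotopic a b ->
    rail_isotopic (multi_knotoid_image h a) (multi_knotoid_image h b).
  by apply: rail_isotopic_image; exact: compact_disc.
(* The image of [k] under [g], then [f], then [e] is isotopic to both its [g]-image and its
   [e]-image. So isotopic [e]-images give isotopic [g]-images, and applying [f] recovers [k] and
   [k']. *)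
move=> kk'; have ek a := im e _ _ (symm _ _ (fg a)).
have gk := trans _ _ _ (ef (multi_knotoid_image g k)) (ek k).
have gk' := trans _ _ _ (ef (multi_knotoid_image g k')) (ek k').
have gg := trans _ _ _ (trans _ _ _ gk kk') (symm _ _ gk').
exact: trans _ _ _ (trans _ _ _ (fg k) (im f _ _ gg)) (symm _ _ (fg k')).
Qed.

(** * Composition of embeddings and the induced maps on classes *)

Lemma comp_open {R : realType} {S1 S2 S3 : set (plane R)}
    (j1 : surface_embedding S1 S2) (j2 : surface_embedding S2 S3) V :
  open V -> V `<=` S1° -> open ((j2 \o j1) @` V).
Proof.
move=> oV VS; rewrite -image_comp; apply: emb_open; first exact: emb_open.
by move=> _ [z /VS Sz <-]; exact: emb_interior.
Qed.

Lemma comp_sub {R : realType} {S1 S2 S3 : set (plane R)}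
    (j1 : surface_embedding S1 S2) (j2 : surface_embedding S2 S3) :
  (j2 \o j1) @` S1 `<=` S3.
Proof.
move=> _ [z Sz <-]; apply: (@emb_sub _ _ _ j2); exists (j1 z) => //.
by apply: (@emb_sub _ _ _ j1); exists z.
Qed.

Lemma comp_embedding {R : realType} {S1 S2 S3 : set (plane R)}
    (j1 : surface_embedding S1 S2) (j2 : surface_embedding S2 S3) :
  embedding S1 (j2 \o j1).
Proof.
have [[c1 i1] [c2 i2]] := (emb_embedding j1, emb_embedding j2).
have s1 := @emb_sub _ _ _ j1; split; first exact: within_comp s1 c1 c2.
move=> z w Sz Sw /= e; apply: i1 => //; apply: i2 => //; apply/mem_set/s1.
- by exists z => //; exact: set_mem.
- by exists w => //; exact: set_mem.
Qed.

Definition comp_surface_embedding {R : realType} {S1 S2 S3 : set (plane R)}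
    (j1 : surface_embedding S1 S2) (j2 : surface_embedding S2 S3) :
    surface_embedding S1 S3 :=
  SurfaceEmbedding (comp_embedding j1 j2) (comp_sub j1 j2)
    (fun V => @comp_open R S1 S2 S3 j1 j2 V).

Lemma multi_knotoid_image_comp {R : realType} {S1 S2 S3 : set (plane R)}
    (j1 : surface_embedding S1 S2) (j2 : surface_embedding S2 S3) k :
  multi_knotoid_image (comp_surface_embedding j1 j2) k =
  multi_knotoid_image j2 (multi_knotoid_image j1 k).
Proof.
apply: multi_knotoid_eq => //=; rewrite image_comp //.
by apply: eq_imagel => C _; rewrite /= image_comp.
Qed.

(** The map is computed on a chosen representative; [rail_isotopic_image] makes the choice
    immaterial. *)
Lemma class_map {R : realType} {S S' : set (plane R)}
    (j : surface_embedding S S') :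
  compact S -> exists F : knotoid_classes S -> knotoid_classes S',
    forall k, F (knotoid_class k) = knotoid_class (multi_knotoid_image j k).
Proof.
move=> cS.
exists (fun c => knotoid_class (multi_knotoid_image j (repr c))) => k.
apply/knotoid_classE/rail_isotopic_image => //.
by apply/knotoid_classE; exact: reprK.
Qed.

Lemma disc_in_annulus {R : realType} :
  inhabited (surface_embedding (disc R) (annulus R)).
Proof.
(* The ratio is 1/8 and the image of the origin is (21/32, 0). First coordinates land between 17/32
   and 25/32 and second ones between -1/8 and 1/8, which keeps squared norms between 1/4 and 1. *)
pose p : plane R := (3 / 4, 0); pose d : R := 7 / 8.
have d1 : d < 1 by rewrite /d; lra.
have emb : embedding (disc R) (toward p d).
  split.
    exact/continuous_subspaceT/toward_continuous.
  by move=> z w _ _; exact: (can_inj (towardK p _ d1)).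
have sub : toward p d @` disc R `<=` annulus R.
  move=> _ [[x y] /disc_square[] + + <-].
  rewrite /annulus /toward /p /d /= !in_itv /= => /andP[x0 x1] /andP[y0 y1].
  by apply/andP; split; nra.
have opn V : open V -> V `<=` (disc R)° -> open (toward p d @` V).
  by move=> oV _; exact: toward_open.
by split; exact: SurfaceEmbedding emb sub opn.
Qed.
Theorem proposition2p7 (R : realType) :
  (forall j : surface_embedding (disc R) (annulus R),
     j @` disc R `<=` (annulus R)° ->
     exists iota : knotoid_classes (disc R) -> knotoid_classes (annulus R),
       (forall k : multi_knotoid (disc R),
          iota (knotoid_class k) = knotoid_class (multi_knotoid_image j k)) /\
       injective iota) /\
  (exists rho : knotoid_classes (annulus R) -> knotoid_classes (disc R),
     (forall k : multi_knotoid (annulus R),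
        rho (knotoid_class k) =
        knotoid_class (multi_knotoid_image (annulus_in_disc R) k)) /\
     set_surj [set: knotoid_classes (annulus R)]
              [set: knotoid_classes (disc R)] rho).
Proof.
pose i := annulus_in_disc R.
have [rho rhoE] := class_map i compact_annulus.
(* On images of the disc, [rho] acts through a self-embedding of the disc, to which the results on
   such embeddings apply. *)
have rho_image (j : surface_embedding (disc R) (annulus R)) k :
    rho (knotoid_class (multi_knotoid_image j k)) =
    knotoid_class (multi_knotoid_image (comp_surface_embedding j i) k).
  by rewrite rhoE multi_knotoid_image_comp.
split=> [j _|].
- have [iota iotaE] := class_map j compact_disc; exists iota; split=> // c c'.
  rewrite -[c]reprK -[c']reprK.
  move=> /(congr1 rho); rewrite !iotaE !rho_image.
  by move=> /knotoid_classE/rail_isotopic_image_inj/knotoid_classE.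
- exists rho; split=> // c _; have [j] := @disc_in_annulus R.
  have [f ef] := image_section (comp_surface_embedding j i).
  (* A preimage of [c]: first apply the right inverse [f] of the self-embedding to a representative,
     then include the result in the annulus by [j]. *)
  pose k := multi_knotoid_image j (multi_knotoid_image f (repr c)).
  exists (knotoid_class k) => //.
  rewrite rho_image -[RHS]reprK; apply/knotoid_classE.
  by apply: Relation_Operators.rst_sym; exact: ef.
Qed.
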